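(* For sufficiently large $x\ge1$ and $z\ge1$ the following hold. (a) If $z\le x^{1/2}$, then $$\sum_{n\le x}(\omega_z(n)-\log\log z)^2=x\log\log z+(B(2)+B^2)x+O\left(\frac{x}{\log z}\right).$$ (b) If $z\le x^{1/3}$, then $$\sum_{n\le x}(\omega_z(n)-\log\log z)^3=(1+3B)x\log\log z+(B(3)+3B(2)B+B^3)x+O\left(\frac{x\log\log z}{\log z}\right).$$ (c) If $z\le x^{1/4}$, then $$\begin{aligned}\sum_{n\le x}(\omega_z(n)-\log\log z)^4&=3x(\log\log z)^2+(6B(2)+4B+6B^2+1)x\log\log z\\&\quad+\left(3B(2)^2-3D(2,2)+B(4)+4B(3)B+6B(2)B^2+B^4\right)x+O\left(\frac{x\log\log z}{\log z}\right).\end{aligned}$$ (d) If $z\le x^{1/5}$, then $$\begin{aligned}\sum_{n\le x}(\omega_z(n)-\log\log z)^5&=(10+15B)x(\log\log z)^2\\&\quad+\left(10(B(3)+B(2))+1+5(6B(2)+1)B+10B^2+10B^3\right)x\log\log z\\&\quad+\big(10(B(3)B(2)-D(3,2))+B(5)+5(3B(2)^2-3D(2,2)+B(4))B\\&\qquad+10B(3)B^2+10B(2)B^3+B^5\big)x+O\left(\frac{x(\log\log z)^2}{\log z}\right).\end{aligned}$$ (e) If $z\le x^{1/6}$, then $$\begin{aligned}\sum_{n\le x}(\omega_z(n)-\log\log z)^6&=15x(\log\log z)^3+(45B(2)+25+60B+45B^2)x(\log\log z)^2\\&\quad+\big(45B(2)^2-45D(2,2)+15(B(2)+B(4))+20B(3)+1\\&\qquad+6(10(B(3)+B(2))+1)B+15(6B(2)+1)B^2+20B^3+15B^4\big)x\log\log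 z\\&\quad+\big(15B(2)^3-45B(2)D(2,2)+30D(2,2,2)+15(B(2)B(4)-D(4,2))\\&\qquad+10(B(3)^2-D(3,3))+B(6)+6(10(B(2)B(3)-D(3,2))+B(5))B\\&\qquad+15(3B(2)^2-3D(2,2)+B(4))B^2+20B(3)B^3+15B(2)B^4+B^6\big)x\\&\quad+O\left(\frac{x(\log\log z)^2}{\log z}\right).\end{aligned}$$
   Context: Sums over $n\le x$ run over natural numbers $n\ge1$; $p$ denotes a prime. $\omega_z(n):=\sum_{p\mid n,\ p\le z}1$ is the number of distinct prime divisors of $n$ not exceeding $z$. $B:=\lim_{x\to\infty}\left(\sum_{p\le x}\frac1p-\log\log x\right)$. For a prime $p$ and an integer $\alpha\ge2$, $G(p^\alpha):=\frac1p\left(1-\frac1p\right)^\alpha+\left(-\frac1p\right)^\alpha\left(1-\frac1p\right)$. For an integer $\alpha\ge 2$, the constant $B(\alpha)$ is defined by $\sum_{p\le z}G(p^\alpha)=\log\log z+B(\alpha)+O\left(\frac1{\log z}\right)$, i.e. $B(\alpha)=\lim_{z\to\infty}\left(\sum_{p\le z}G(p^\alpha)-\log\log z\right)$. For $l\ge2$ and integers $\alpha_1,\dots,\alpha_l\ge2$ (not necessarily distinct), $D(\alpha_1,\dots,\alpha_l):=\sum_{p}G(p^{\alpha_1})\cdots G(p^{\alpha_l})$, the (convergent) sum over all primes. *)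

(* Defs.v *)
From mathcomp Require Import all_boot all_order all_algebra.
From mathcomp Require Import all_classical all_reals all_analysis.

Set Implicit Arguments.
Unset Strict Implicit.
Unset Printing Implicit Defensive.

Import Order.TTheory GRing.Theory Num.Theory.
Import numFieldNormedType.Exports.

Local Open Scope classical_set_scope.
Local Open Scope ring_scope.

(* For a real x >= 0, the naturals n with 1 <= n <= x are those with
   1 <= n < (Num.truncn x).+1, since Num.truncn is the floor on x >= 0. *)

Definition omega (R : realType) (z : R) (n : nat) : nat :=
  count (fun p : nat => p%:R <= z) (primes n).

Definition loglog (R : realType) (z : R) : R := ln (ln z).

Definition mertensB (R : realType) : R :=
  lim ((\sum_(1 <= p < (Num.truncn x).+1 | prime p) p%:R^-1 - loglog x)
         @[x --> (+oo : set_system R)]).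

(* G(p^alpha) *)
Definition G (R : realType) (p alpha : nat) : R :=
  p%:R^-1 * (1 - p%:R^-1) ^+ alpha + (- p%:R^-1) ^+ alpha * (1 - p%:R^-1).

Definition Balpha (R : realType) (alpha : nat) : R :=
  lim ((\sum_(1 <= p < (Num.truncn z).+1 | prime p) G R p alpha - loglog z)
         @[z --> (+oo : set_system R)]).

(* D(alpha_1, ..., alpha_l), as a limit of partial sums over primes p < N *)
Definition Dalpha (R : realType) (s : seq nat) : R :=
  limn (fun N : nat =>
    \sum_(0 <= p < N | prime p) \prod_(alpha <- s) G R p alpha).

Definition moment (R : realType) (k : nat) (x z : R) : R :=
  \sum_(1 <= n < (Num.truncn x).+1) ((omega z n)%:R - loglog z) ^+ k.

(* Main.v *)
(* Write [omega z n - loglog z] as [c + \sum_(p <= z) f_p n], where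
   [f_p n = (p %| n) - 1/p] and [c = \sum_(p <= z) 1/p - loglog z].  The Chinese
   remainder theorem makes the [f_p] independent on average: adding one prime at
   a time, the k-th power sum over [n <= x] differs from [x] times the k-th moment
   of a sum of independent variables by at most [(|c| + 2 pi(z)) ^ k], which is
   [O(x / ln z)] as soon as [z ^ k <= x], by Chebyshev's bound on [pi(z)].
   The model moments are explicit polynomials in [c], the sums of [G(p^a)] and
   the sums of products of [G]'s over the primes [p <= z]; Mertens' second theorem
   with error [O(1 / ln z)] evaluates all of these. *)
Require Import Defs.
From mathcomp Require Import all_boot all_order all_algebra.
From mathcomp Require Import all_classical all_reals all_analysis.
From mathcomp Require Import zify ring lra.

Set Implicit Arguments.
Unset Strict Implicit.
Unset Printing Implicit Defensive.

Import Order.TTheory GRing.Theory Num.Theory.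
Import numFieldNormedType.Exports.

Local Open Scope ring_scope.

(** * Chebyshev's bound *)

Lemma prime_dvdn_fact (p n : nat) : prime p -> (p %| n`!)%N = (p <= n)%N.
Proof.
move=> pp; apply/idP/idP => [|lepn]; last by rewrite dvdn_fact// prime_gt0.
elim: n => [|n IH]; first by rewrite Euclid_dvd1.
by rewrite factS Euclid_dvdM// => /orP[/dvdn_leq->//|/IH/leqW].
Qed.

(** Such a prime divides (2n)! but neither factor n! of the denominator of the binomial
    coefficient. *)
Lemma dvdn_bin_double (p n : nat) :
  prime p -> (n < p <= n.*2)%N -> (p %| 'C(n.*2, n))%N.
Proof.
move=> pp /andP[ltnp lep].
have : (p %| n.*2`!)%N by rewrite prime_dvdn_fact.
have -> : n.*2`! = ('C(n.*2, n) * (n`! * n`!))%N.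
  by rewrite -(@bin_fact n.*2 n) ?(leq_trans (ltnW ltnp) lep)// -addnn addKn.
by rewrite !Euclid_dvdM// !prime_dvdn_fact// leqNgt ltnp/= orbF.
Qed.

Lemma bin_double_le (n : nat) : ('C(n.*2, n) <= 2 ^ n.*2)%N.
Proof.
rewrite -[2%N]/(1 + 1)%N expnDn.
have hn : (n < n.*2.+1)%N by lia.
by rewrite (bigD1 (Ordinal hn))//= !exp1n !muln1 leq_addr.
Qed.

Section logarithms.
Variable R : realType.
Implicit Types (m n p N M : nat) (x y z : R).

Lemma ln_nat_ge0 n : 0 <= ln (n%:R : R).
Proof. by case: n => [|n]; [rewrite ln0|rewrite ln_ge0// ler1n]. Qed.

Lemma le_ln x y : 0 < x -> x <= y -> ln x <= ln y.
Proof. by move=> x0 xy; rewrite ler_ln ?posrE// (lt_le_trans x0). Qed.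

Lemma ln_div_le x y : 0 < x -> 0 < y -> ln y - ln x <= y / x - 1.
Proof.
move=> x0 y0; rewrite -ln_div ?posrE//.
have -> : y / x = 1 + (y / x - 1) by ring.
by apply: (le_trans (le_ln1Dx _)); [have := divr_gt0 y0 x0; lra|lra].
Qed.

Lemma ln_div_ge x y : 0 < x -> 0 < y -> 1 - x / y <= ln y - ln x.
Proof. by move=> x0 y0; have := ln_div_le y0 x0; lra. Qed.

Lemma ln_prodn (I : Type) (r : seq I) (P : pred I) (F : I -> nat) :
  (forall i, P i -> (0 < F i)%N) ->
  ln ((\prod_(i <- r | P i) F i)%N%:R : R) = \sum_(i <- r | P i) ln (F i)%:R.
Proof.
move=> F0; rewrite natr_prod.
suff [] : 0 < \prod_(i <- r | P i) (F i)%:R :> R /\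
  ln (\prod_(i <- r | P i) (F i)%:R : R) = \sum_(i <- r | P i) ln (F i)%:R by [].
elim/big_rec2 : _ => [|i y x Pi [x0 IH]]; first by rewrite ltr01 ln1.
have Fi0 : 0 < (F i)%:R :> R by rewrite ltr0n F0.
by rewrite mulr_gt0// lnM ?posrE// IH.
Qed.

(** The logarithm of the prime factorization of [m]. The cutoff [N] may lie below or above [m], as
    long as it covers all prime divisors. *)
Lemma ln_sum_logn N m : (0 < m)%N ->
  (forall p, prime p -> (p %| m)%N -> (p <= N)%N) ->
  ln (m%:R : R) = \sum_(1 <= p < N.+1 | prime p) (logn p m)%:R * ln p%:R.
Proof.
move=> m0 mN.
(* The product is extended to [maxn m N] so that it can be cut at [N]. Indices that are not prime
   divisors of [m] have exponent 0 and contribute ln 1 = 0. *)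
rewrite -[in LHS](partnT m0) (@widen_partn (maxn m N)) ?leq_maxl// ln_prodn; last first.
  by move=> [|p] _; [rewrite lognE expn0|rewrite expn_gt0].
rewrite big_ltn// lognE/= expn0 ln1 add0r (big_cat_nat _ (n := N.+1))//=; last first.
  by rewrite ltnS leq_maxr.
rewrite [X in _ + X]big1_seq ?addr0 => [|p]; last first.
  rewrite mem_index_iota => /andP[_ /andP[Np _]].
  rewrite lognE; case: ifPn => [/and3P[pp _ /(mN _ pp)]|]; last by rewrite ln1.
  by rewrite leqNgt Np.
rewrite [RHS]big_mkcond/=; apply: eq_bigr => p _.
case: ifPn => [pp|npp]; last by rewrite lognE (negbTE npp) ln1.
by rewrite natrX lnXn ?ltr0n ?prime_gt0// mulr_natl.
Qed.

Lemma ln_fact_sum N :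
  ln (N`!%:R : R) = \sum_(1 <= p < N.+1 | prime p) (logn p N`!)%:R * ln p%:R.
Proof.
by apply: ln_sum_logn => [|p pp]; rewrite ?fact_gt0// prime_dvdn_fact.
Qed.

Lemma ln_fact_le N : ln (N`!%:R : R) <= N%:R * ln N%:R.
Proof.
elim: N => [|N IH]; first by rewrite ln1 mul0r.
rewrite factS natrM lnM ?posrE ?ltr0n ?fact_gt0//.
rewrite [N.+1%:R * _](_ : _ = ln N.+1%:R + N%:R * ln N.+1%:R); last first.
  by rewrite -[N.+1]addn1 natrD; ring.
rewrite lerD2l (le_trans IH)//.
case: N {IH} => [|N]; first by rewrite !mul0r.
by rewrite ler_wpM2l// le_ln ?ltr0n// ler_nat.
Qed.

Lemma ln_fact_ge N : N%:R * ln N%:R - N%:R <= ln (N`!%:R : R).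
Proof.
elim: N => [|N IH]; first by rewrite ln1 mul0r subr0.
rewrite factS natrM lnM ?posrE ?ltr0n ?fact_gt0//.
case: N IH => [|N] IH; first by rewrite fact0 !ln1; lra.
set u : R := N.+1%:R in IH *; have u0 : 0 < u by rewrite ltr0n.
have -> : N.+2%:R = u + 1 :> R by rewrite natr1.
have u10 : 0 < u + 1 by lra.
have := ln_div_le u0 u10.
have -> : (u + 1) / u - 1 = u^-1 by field; lra.
move=> /(ler_wpM2l (ltW u0)); rewrite divff ?gt_eqF// => h; lra.
Qed.

Definition theta N : R := \sum_(1 <= p < N.+1 | prime p) ln p%:R.

(** Every prime in (n, 2n] divides the central binomial coefficient, whose logarithm is at most 2n
    ln 2, and ln 2 <= 1. *)
Lemma theta_double n : theta n.*2 <= theta n + n.*2%:R.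
Proof.
rewrite /theta (big_cat_nat _ (n := n.+1))//=; last by lia.
rewrite lerD2l.
have C0 : (0 < 'C(n.*2, n))%N by rewrite bin_gt0; lia.
apply: (@le_trans _ _ (ln ('C(n.*2, n)%:R : R))); last first.
  have : (ln ('C(n.*2, n)%:R : R) <= ln ((2 ^ n.*2)%:R)).
    by rewrite le_ln ?ltr0n// ler_nat bin_double_le.
  move=> /le_trans; apply; rewrite natrX lnXn// -[ln _ *+ _]mulr_natl.
  by rewrite ler_piMr//; apply: (@le_ln1Dx R 1); lra.
rewrite (@ln_sum_logn (maxn 'C(n.*2, n) n.*2))//; last first.
  by move=> p _ /dvdn_leq -/(_ C0); rewrite leq_max => ->.
rewrite [leRHS](big_cat_nat _ (n := n.+1))//=; last by lia.
rewrite -[leLHS]add0r lerD//.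
  by apply: sumr_ge0 => p _; rewrite mulr_ge0// ln_nat_ge0.
rewrite [leRHS](big_cat_nat _ (n := n.*2.+1))//=; [|lia|lia].
rewrite -[leLHS]addr0 lerD//; last first.
  by apply: sumr_ge0 => p _; rewrite mulr_ge0// ln_nat_ge0.
rewrite big_seq_cond [leRHS]big_seq_cond; apply: ler_sum => p.
rewrite mem_index_iota => /andP[/andP[np pn] pp].
by rewrite ler_peMl ?ln_nat_ge0// ler1n logn_gt0 mem_primes pp C0 dvdn_bin_double// np.
Qed.

Lemma theta_homo m n : (m <= n)%N -> theta m <= theta n.
Proof.
move=> mn; rewrite [leRHS](big_cat_nat _ (n := m.+1))//= lerDl.
by apply: sumr_ge0 => p _; rewrite ln_nat_ge0.
Qed.

(** Strong induction by halving. With m = N/2 rounded up, the bound is 6m + 2m = 8m <= 4(N + 1) <=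
    6N for N >= 2; the constant 6 absorbs the rounding. *)
Lemma theta_le N : theta N <= 6 * N%:R.
Proof.
elim/ltn_ind: N => N IH; case: (leqP N 1) => [N1|N2].
  rewrite /theta big_mkcond big1_seq ?mulr_ge0// => p.
  rewrite mem_index_iota => /andP[_ /andP[_ pN]].
  by rewrite ifN//; apply/negP => /prime_gt1; lia.
pose m := uphalf N.
have mN : (m < N)%N by rewrite /m; lia.
have Nm : (N <= m.*2)%N by rewrite /m; lia.
apply: (le_trans (theta_homo Nm)); apply: (le_trans (theta_double m)).
apply: (le_trans (lerD (IH _ mN) (lexx _))).
have : (6 * m + m.*2 <= 6 * N)%N by rewrite /m; lia.
by rewrite -(ler_nat R) natrD !natrM.
Qed.

End logarithms.

(** * Mertens' first theorem *)

Section mertens.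
Variable R : realType.
Implicit Types (m n p N M : nat) (x y z : R).

Definition mertensA N : R := \sum_(1 <= p < N.+1 | prime p) ln p%:R / p%:R.

Lemma sum_ln_telescope N :
  \sum_(2 <= n < N.+1) ln (n%:R : R) / (n * n.-1)%:R <= 2.
Proof.
(* The subtracted term (ln N + 2) / N approximates the tail of the series; with it the bound is
   strong enough for induction on [N]. *)
suff h : (0 < N)%N -> \sum_(2 <= n < N.+1) ln (n%:R : R) / (n * n.-1)%:R
    <= 2 - (ln N%:R + 2) / N%:R.
  case: (posnP N) => [->|N0]; first by rewrite big_geq.
  by rewrite (le_trans (h N0))// gerBl divr_ge0// addr_ge0 ?ln_nat_ge0.
elim: N => // -[_ _|N /(_ isT) IH _]; first by rewrite big_geq// ln1; lra.
rewrite big_nat_recr//= (le_trans (lerD IH (lexx _)))//.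
set u : R := N.+1%:R; have u1 : 1 <= u by rewrite ler1n.
have -> : (N.+2 * N.+1)%:R = (u + 1) * u :> R by rewrite natrM -[N.+2]addn1 natrD.
have -> : N.+2%:R = u + 1 :> R by rewrite -[N.+2]addn1 natrD.
have u0 : 0 < u by lra.
have u10 : 0 < u + 1 by lra.
have h := ln_div_le u0 u10.
have h1 : u * (ln (u + 1) - ln u) <= 1.
  apply: (le_trans (ler_wpM2l (ltW u0) h)).
  by rewrite [leLHS](_ : _ = 1)//; field; lra.
rewrite -subr_ge0.
have -> : 2 - (ln (u + 1) + 2) / (u + 1) - (2 - (ln u + 2) / u + ln (u + 1) / ((u + 1) * u))
  = (2 - u * (ln (u + 1) - ln u) - (ln (u + 1) - ln u)) / ((u + 1) * u).
  by field; rewrite !gt_eqF.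
apply: divr_ge0; last by apply: mulr_ge0; lra.
have : 0 <= ln (u + 1) - ln u by rewrite subr_ge0 le_ln//; lra.
by nra.
Qed.

(** Only the first term of Legendre's formula is kept. *)
Lemma logn_fact_ge p N : prime p -> (N%:R / p%:R - 1 : R) <= (logn p N`!)%:R.
Proof.
move=> pp; have p0 : 0 < p%:R :> R by rewrite ltr0n prime_gt0.
case: N => [|N]; first by rewrite mul0r sub0r (@le_trans _ _ 0)// oppr_le0.
rewrite lerBlDr ler_pdivrMr// natr1 -natrM ler_nat.
apply: (leq_trans (ltnW (ltn_ceil N.+1 (prime_gt0 pp)))).
by rewrite leq_mul2r logn_fact// big_ltn// expn1 ltnS leq_addr orbT.
Qed.

(** Dropping the floors in Legendre's formula leaves a geometric series. *)
Lemma logn_fact_le p N : prime p -> (logn p N`!)%:R <= N%:R / (p%:R - 1) :> R.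
Proof.
move=> pp; have p2 : 2 <= p%:R :> R by rewrite ler_nat prime_gt1.
have p0 : 0 < p%:R :> R by lra.
rewrite logn_fact// natr_sum.
apply: (@le_trans _ _ (\sum_(1 <= k < N.+1) N%:R * p%:R ^- k)).
  apply: ler_sum => k _; rewrite ler_pdivlMr ?exprn_gt0// -natrX -natrM ler_nat.
  exact: leq_divM.
rewrite -mulr_sumr ler_wpM2l//.
have -> : \sum_(1 <= k < N.+1) (p%:R : R) ^- k = (1 - p%:R ^- N) / (p%:R - 1).
  elim: N => [|N IH]; first by rewrite big_geq// expr0 invr1 subrr mul0r.
  rewrite big_nat_recr//= IH exprS; field.
  by rewrite expf_neq0 ?gt_eqF//=; lra.
by rewrite ler_pdivrMr ?mulVf; [|lra|lra]; rewrite gerBl invr_ge0 exprn_ge0// ltW.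
Qed.

(* From two-sided bounds on Legendre's formula for [ln N!]. *)
Lemma mertens1 N : (0 < N)%N -> `|mertensA N - ln N%:R| <= 6.
Proof.
move=> N0; have NR : 0 < N%:R :> R by rewrite ltr0n.
rewrite ler_norml lerBrDr; apply/andP; split.
  (* Here 1/(p-1) = 1/p + 1/(p(p-1)), and the second part contributes at most the 2 of
     [sum_ln_telescope]. *)
  have : ln (N`!%:R : R) <= N%:R * (mertensA N + 2).
    rewrite ln_fact_sum.
    apply: (@le_trans _ _ (\sum_(1 <= p < N.+1 | prime p)
      N%:R * (ln p%:R / p%:R + ln p%:R / (p * p.-1)%:R))).
      apply: ler_sum => p pp.
      have p2 : 2 <= p%:R :> R by rewrite ler_nat prime_gt1.
      apply: (le_trans (ler_wpM2r (ln_nat_ge0 _ _) (logn_fact_le _ pp))).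
      rewrite natrM [p.-1%:R](_ : _ = p%:R - 1); last by rewrite -subn1 natrB ?prime_gt0.
      rewrite -subr_ge0 [leRHS](_ : _ = 0)//; field; by rewrite !gt_eqF//; lra.
    rewrite -mulr_sumr big_split/= ler_wpM2l// lerD2l.
    apply: le_trans (sum_ln_telescope N).
    rewrite big_mkcond/= big_ltn//= add0r.
    apply: ler_sum => p _; case: ifP => // _.
    by rewrite divr_ge0// ln_nat_ge0.
  move=> /(le_trans (ln_fact_ge R N)).
  by rewrite -[X in _ - X]mulr1 -mulrBr ler_pM2l//; lra.
rewrite lerBlDr.
(* Rounding N/p down loses ln p for each prime, [theta N] in total; Chebyshev's bound on it is the
   source of the constant 6. *)
have : N%:R * mertensA N - theta R N <= ln (N`!%:R : R).
  rewrite ln_fact_sum mulr_sumr -sumrB; apply: ler_sum => p pp.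
  have := ler_wpM2r (ln_nat_ge0 R p) (logn_fact_ge N pp).
  by rewrite mulrBl mul1r mulrA mulrAC.
move=> /le_trans/(_ (ln_fact_le _ N)); have := theta_le R N => h1 h2.
rewrite -(ler_pM2l NR) mulrDr; lra.
Qed.

(** A prime p > sqrt x has ln x <= 2 ln p, so these are paid for by 2 theta(x) <= 12x. There are at
    most sqrt x smaller ones, costing sqrt x * ln x <= 2x; together this gives 14. *)
Lemma prime_count x : 2 <= x ->
  (size [seq p <- index_iota 1 (Num.truncn x).+1 | prime p])%:R <= 14 * x / ln x :> R.
Proof.
move=> x2; have x0 : 0 < x by lra.
have lx : 0 < ln x by rewrite ln_gt0; lra.
pose s := Num.sqrt x; have s0 : 0 < s by rewrite sqrtr_gt0.
have sx : s ^+ 2 = x by rewrite sqr_sqrtr// ltW.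
have lnsx : ln x = 2 * ln s by rewrite -sx lnXn// mulr_natl.
have lss : ln s <= s by exact/ltW/ln_sublinear.
have xN : (Num.truncn x)%:R <= x by rewrite truncn_le ltW.
rewrite -sum1_size big_filter natr_sum ler_pdivlMr// mulr_suml.
apply: (@le_trans _ _ (\sum_(1 <= p < (Num.truncn x).+1 | prime p)
   (2 * ln p%:R + (if (p <= Num.truncn s)%N then ln x else 0)))).
  apply: ler_sum => p pp; rewrite mul1r; case: ifPn => [_|].
    by rewrite lerDr mulr_ge0// ln_nat_ge0.
  by rewrite -ltnNge truncn_lt_nat ?(ltW s0)// => /ltW sp; rewrite addr0 lnsx ler_pM2l// le_ln.
rewrite big_split/= -mulr_sumr.
have h1 := theta_le R (Num.truncn x).
have h2 : \sum_(1 <= p < (Num.truncn x).+1 | prime p)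
    (if (p <= Num.truncn s)%N then ln x else 0) <= s * ln x.
  rewrite -big_mkcondr/=.
  apply: (@le_trans _ _ (\sum_(1 <= p < (Num.truncn x).+1 | (p <= Num.truncn s)%N) ln x)).
    rewrite [leRHS](bigID prime)/=; under [X in X + _]eq_bigl do rewrite andbC.
    by rewrite lerDl sumr_ge0// => i _; exact: ltW.
  have ssx : s <= x by nra.
  under eq_bigl do rewrite -ltnS -[(_ < _)%N]andTb.
  rewrite -(@big_nat_widen _ _ _ _ _ _ xpredT) ?ltnS ?le_truncn//.
  rewrite sumr_const_nat subn1/= -mulr_natl ler_wpM2r// ?(ltW lx)//.
  by rewrite truncn_le ltW.
have : s * ln x <= 2 * x by rewrite lnsx -sx expr2; nra.
rewrite /theta in h1; lra.
Qed.

End mertens.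

(** * Mertens' second theorem *)

Lemma ler_norm4D (R : realDomainType) (a b c d A B C D : R) :
  `|a| <= A -> `|b| <= B -> `|c| <= C -> `|d| <= D ->
  `|a + b + c + d| <= A + B + C + D.
Proof.
by move=> *; do 3 (apply: le_trans (ler_normD _ _) _; apply: lerD => //).
Qed.

Section mertens2.
Variable R : realType.
Variables (g : nat -> R) (K : R).
Hypothesis gK : forall p, prime p -> `|g p - p%:R^-1| <= K / p%:R ^+ 2.

(** Keeping [g] general treats 1/p and all the local factors G(p^a) at once, hence both [mertensB]
    and [Balpha]. *)
Definition prime_sum (N : nat) : R := \sum_(1 <= p < N.+1 | prime p) g p.

Lemma deviation_bound_ge0 : 0 <= K.
Proof.
have := le_trans (normr_ge0 _) (@gK 2%N isT).
by rewrite pmulr_lge0// invr_gt0 exprn_gt0.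
Qed.

(* Summation by parts against [1 / ln], with the boundary term kept on the left
   so that every step of the induction is a telescoping estimate. *)
Lemma mertens2_abel (M N : nat) : (2 <= M)%N -> (M <= N)%N ->
  `|prime_sum N - ln (ln N%:R) - (prime_sum M - ln (ln M%:R))
     - (mertensA R N - ln N%:R) / ln N%:R| <=
  6 * (2 / ln M%:R - (ln N%:R)^-1) + ((ln M%:R)^-1 - (ln N%:R)^-1)
  + K * (M%:R^-1 - N%:R^-1).
Proof.
move=> M2; elim: N => [|N IH]; first by case: M M2.
have lnM0 : 0 < ln M%:R :> R by rewrite ln_gt0// ltr1n.
rewrite leq_eqVlt => /orP[/eqP <-|].
  rewrite !subrr mulr0 !addr0 add0r normrN normrM (@ger0_norm _ (_^-1)) ?invr_ge0 ?(ltW lnM0)//.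
  rewrite [leRHS](_ : _ = 6 * (ln M%:R)^-1); last by ring.
  by rewrite ler_wpM2r ?invr_ge0 ?(ltW lnM0)// mertens1// (ltn_trans _ M2).
rewrite ltnS => MN; have {IH} := IH MN.
have N2 : (2 <= N)%N := leq_trans M2 MN.
set u : R := ln N%:R; set v : R := ln N.+1%:R.
have N0 : 0 < N%:R :> R by rewrite ltr0n (leq_trans _ N2).
have N10 : 0 < N.+1%:R :> R by rewrite ltr0n.
have N1E : N.+1%:R = N%:R + 1 :> R by rewrite natr1.
have u0 : 0 < u by rewrite ln_gt0// ltr1n.
have uv : u <= v by rewrite le_ln// ler_nat.
have v0 : 0 < v by lra.
have vu1 : v - u <= 1.
  apply: (le_trans (ln_div_le N0 N10)).
  rewrite N1E mulrDl divff ?gt_eqF// mul1r addrAC subrr add0r invf_le1//.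
  by rewrite ler1n (leq_trans _ N2).
have r1 : `|mertensA R N - u| <= 6 by rewrite mertens1// (leq_trans _ N2).
have uv' : 0 <= u^-1 - v^-1 by rewrite subr_ge0 lef_pV2.
(* When N+1 is prime, the new term of [mertensA] divided by ln(N+1) is exactly 1/(N+1), so only the
   deviation of [g] remains. *)
pose q : R := (prime N.+1)%:R * (g N.+1 - N.+1%:R^-1).
have qK : `|q| <= K * (N%:R^-1 - N.+1%:R^-1).
  have h : K / N.+1%:R ^+ 2 <= K * (N%:R^-1 - N.+1%:R^-1).
    rewrite ler_wpM2l ?deviation_bound_ge0// N1E -subr_ge0.
    rewrite (_ : _ - _ = (N%:R * (N%:R + 1) ^+ 2)^-1).
      by rewrite invr_ge0 mulr_ge0 ?exprn_ge0 ?addr_ge0.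
    by field; rewrite -N1E !gt_eqF.
  rewrite /q; case: (boolP (prime N.+1)) => [pN|_].
    by rewrite mul1r (le_trans (gK pN)).
  by rewrite mul0r normr0 (le_trans _ h)// divr_ge0 ?deviation_bound_ge0 ?exprn_ge0.
(* The increment ln v - ln u lies between (v-u)/v and (v-u)/u, whose gap (v-u)(1/u - 1/v) telescopes
   because v - u <= 1. *)
pose w : R := (v - u) / v - (ln v - ln u).
have wK : `|w| <= u^-1 - v^-1.
  have h1 := ln_div_le u0 v0; have h2 := ln_div_ge u0 v0.
  have e1 : (v - u) / v = 1 - u / v by rewrite mulrBl divff ?gt_eqF.
  have e2 : (v - u) * (u^-1 - v^-1) = v / u - 1 - (1 - u / v) by field; rewrite !gt_eqF.
  have h3 : (v - u) * (u^-1 - v^-1) <= u^-1 - v^-1 by rewrite ler_piMl.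
  by rewrite ler_norml /w e1; lra.
have sE (h : nat -> R) : \sum_(1 <= p < N.+2 | prime p) h p
    = \sum_(1 <= p < N.+1 | prime p) h p + (prime N.+1)%:R * h N.+1.
  rewrite big_mkcond big_nat_recr//= -big_mkcond/=; congr (_ + _).
  by case: ifP => _; rewrite ?mul1r ?mul0r.
move=> IH.
rewrite [X in `|X|](_ : _ = (prime_sum N - ln u - (prime_sum M - ln (ln M%:R))
     - (mertensA R N - u) / u) + (mertensA R N - u) * (u^-1 - v^-1) + q + w); last first.
  rewrite /prime_sum /mertensA /w /q !sE -/u -/v; field.
  by rewrite ?natr1 ?nat1r !gt_eqF.
apply: le_trans (ler_norm4D IH (_ : _ <= 6 * (u^-1 - v^-1)) qK wK) _; last first.
  by rewrite le_eqVlt; apply/orP; left; apply/eqP; ring.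
by rewrite normrM (ger0_norm uv') ler_wpM2r.
Qed.

(** Moving the boundary term to the right costs 6 / ln N, which the negative terms of the Abel bound
    absorb; 13 = 6 * 2 + 1. *)
Lemma mertens2_nat (M N : nat) : (2 <= M)%N -> (M <= N)%N ->
  `|prime_sum N - ln (ln N%:R) - (prime_sum M - ln (ln M%:R))| <=
  (13 + K) / ln M%:R.
Proof.
move=> M2 MN; have N2 : (2 <= N)%N := leq_trans M2 MN.
have M0 : 0 < M%:R :> R by rewrite ltr0n (leq_trans _ M2).
have N0 : 0 < N%:R :> R by rewrite ltr0n (leq_trans _ N2).
have lM : 0 < ln M%:R :> R by rewrite ln_gt0// ltr1n.
have lN : 0 < ln N%:R :> R by rewrite ln_gt0// ltr1n.
set T := (X in `|X|).
have h1 := mertens2_abel M2 MN; rewrite -/T in h1.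
have r1 : `|(mertensA R N - ln N%:R) / ln N%:R| <= 6 * (ln N%:R)^-1.
  rewrite normrM (@ger0_norm _ (_^-1)) ?invr_ge0 ?(ltW lN)//.
  by rewrite ler_wpM2r ?invr_ge0 ?(ltW lN)// mertens1// (leq_trans _ N2).
have h2 : K * (M%:R^-1 - N%:R^-1) <= K / ln M%:R.
  rewrite ler_wpM2l ?deviation_bound_ge0// (@le_trans _ _ M%:R^-1)//.
    by rewrite gerBl invr_ge0.
  by rewrite lef_pV2 ?posrE//; exact/ltW/ln_sublinear.
have := ler_normD (T - (mertensA R N - ln N%:R) / ln N%:R) ((mertensA R N - ln N%:R) / ln N%:R).
rewrite subrK => /le_trans; apply; apply: le_trans (lerD h1 r1) _.
have : 0 < (ln N%:R : R)^-1 by rewrite invr_gt0.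
by lra.
Qed.

(** Replacing a real number by its floor at most doubles 1/ln and shifts loglog by at most 2/ln,
    whence 30 + 2K = 2(13 + K) + 2 + 2. *)
Lemma mertens2_real (z w : R) : 4 <= z -> z <= w ->
  `|prime_sum (Num.truncn w) - loglog w - (prime_sum (Num.truncn z) - loglog z)|
  <= (30 + 2 * K) / ln z.
Proof.
have key (x : R) : 4 <= x -> [/\ (2 <= Num.truncn x)%N, 0 < ln x,
    (ln (Num.truncn x)%:R)^-1 <= 2 / ln x
    & `|loglog x - ln (ln (Num.truncn x)%:R)| <= 2 / ln x].
  move=> x4; have x0 : 0 <= x by lra.
  set N := Num.truncn x.
  have N2 : (2 <= N)%N by rewrite truncn_ge_nat//; lra.
  have N0 : 0 < N%:R :> R by rewrite ltr0n (leq_trans _ N2).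
  have N1 : 2 <= N%:R :> R by rewrite ler_nat.
  have /andP[Nx xN] := truncn_itv x0; rewrite -/N -natr1 in Nx xN.
  have lN : 0 < ln N%:R :> R by rewrite ln_gt0// ltr1n.
  have lx : 0 < ln x by rewrite ln_gt0//; lra.
  have lNx : ln N%:R <= ln x by rewrite le_ln.
  have h1 : ln x <= 2 * ln N%:R.
    by rewrite mulr_natl -lnXn// le_ln//; [lra|rewrite expr2; nra].
  have h2 : (ln N%:R)^-1 <= 2 / ln x.
    by rewrite -invf_div lef_pV2 ?posrE//; [lra|apply: divr_gt0].
  split => //; rewrite /loglog ger0_norm ?subr_ge0 ?le_ln//.
  apply: le_trans (ln_div_le lN lx) _; apply: le_trans h2.
  rewrite -{2}(divff (lt0r_neq0 lN)) -mulrBl ler_piMl ?invr_ge0 ?(ltW lN)//.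
  apply: le_trans (ln_div_le N0 _) _; first by lra.
  by rewrite lerBlDr ler_pdivrMr//; lra.
move=> z4 zw; have w4 : 4 <= w by lra.
have [z1 z2 z3 z5] := key _ z4; have [w1 w2 w3 w5] := key _ w4.
have MN : (Num.truncn z <= Num.truncn w)%N by exact: le_truncn.
have h := mertens2_nat z1 MN.
have hz : (ln w)^-1 <= (ln z)^-1 by rewrite lef_pV2 ?posrE// le_ln//; lra.
have h' : (13 + K) / ln (Num.truncn z)%:R <= (13 + K) * (2 / ln z).
  by rewrite ler_wpM2l// addr_ge0// deviation_bound_ge0.
move: h z5 w5; rewrite !ler_norml => /andP[a1 a2] /andP[a3 a4] /andP[a5 a6].
by apply/andP; split; lra.
Qed.

End mertens2.

(** * Limits along a filter, with explicit error bounds *)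

Section limits.
Local Open Scope classical_set_scope.
Variables (R : realType) (T : Type) (F : set_system T) (FF : ProperFilter F).
Variable f : T -> R.

Lemma cvg_of_cauchy_at :
  (forall e : R, 0 < e -> exists a, \forall b \near F, `|f a - f b| <= e) ->
  cvg (f x @[x --> F]).
Proof.
move=> h; apply: cauchy_cvg; apply: cauchy_exP => e e0.
have [a ha] := h (e / 2) (divr_gt0 e0 (ltr0Sn _ _)).
exists (f a); rewrite /fmap/=; near=> b.
rewrite /ball/=; apply: (@le_lt_trans _ _ (e / 2)); last by lra.
by near: b.
Unshelve. all: by end_near. Qed.

(** Lets the second argument of a tail estimate go to the limit, keeping the explicit bound. *)
Lemma lim_dist_le a e : cvg (f x @[x --> F]) ->
  (\forall b \near F, `|f a - f b| <= e) -> `|f a - lim (f x @[x --> F])| <= e.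
Proof.
move=> cf h; apply/ler_addgt0Pr => d d0.
have /cvgrPdist_le/(_ d d0) h2 := cf.
near F => b.
have -> : f a - lim (f x @[x --> F]) = (f a - f b) + - (lim (f x @[x --> F]) - f b) by ring.
apply: le_trans (ler_normD _ _) _; rewrite normrN lerD//.
  by near: b.
by near: b.
Unshelve. all: by end_near. Qed.

End limits.

Lemma mertens2 (R : realType) (g : nat -> R) (K : R) :
  (forall p, prime p -> `|g p - p%:R^-1| <= K / p%:R ^+ 2) ->
  forall z : R, 4 <= z ->
  `|\sum_(1 <= p < (Num.truncn z).+1 | prime p) g p - loglog z
    - lim ((\sum_(1 <= p < (Num.truncn x).+1 | prime p) g p - loglog x)
         @[x --> (+oo : set_system R)])%classic| <= (30 + 2 * K) / ln z.
Proof.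
move=> gK z z4; have K0 := deviation_bound_ge0 gK.
pose f (x : R) := prime_sum g (Num.truncn x) - loglog x.
have near_le (a : R) : 4 <= a ->
    (\forall b \near (+oo : set_system R), `|f a - f b| <= (30 + 2 * K) / ln a)%classic.
  move=> a4; apply: filterS (nbhs_pinfty_ge (num_real a)) => b ab.
  by rewrite distrC; apply: (mertens2_real gK).
apply: (@lim_dist_le R R _ _ f); last exact: near_le.
apply: cvg_of_cauchy_at => e e0.
(* Chosen so that (30 + 2K) / ln a <= e. *)
pose a := Num.max 4 (expR ((30 + 2 * K) / e)).
have a4 : 4 <= a by rewrite le_max lexx.
exists a; apply: filterS (near_le a a4) => b /le_trans; apply.
have : (30 + 2 * K) / e <= ln a.
  by rewrite -[leLHS]expRK le_ln ?expR_gt0// le_max lexx orbT.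
have la : 0 < ln a by rewrite ln_gt0//; lra.
by rewrite !ler_pdivrMr// [e * _]mulrC.
Qed.

(** * Local factors and the independent model *)

Section local_factor.
Variable R : realType.
Implicit Types (p i a : nat).

Lemma invp_itv p : prime p -> 0 < (p%:R^-1 : R) <= 2^-1.
Proof.
move=> pp; rewrite invr_gt0 ltr0n prime_gt0//= lef_pV2 ?posrE ?ltr0n ?prime_gt0//.
by rewrite ler_nat prime_gt1.
Qed.

Lemma G_exp0 p : G R p 0 = 1. Proof. by rewrite /G !expr0; ring. Qed.

Lemma G_exp1 p : G R p 1 = 0. Proof. by rewrite /G !expr1; ring. Qed.

(** Bernoulli's inequality gives (1-t)^a >= 1 - at for t = 1/p, and the second summand of [G] is at
    most t^2. This is the hypothesis of [mertens2] with K = a + 1. *)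
Lemma normr_GB_le p a : prime p -> (2 <= a)%N ->
  `|G R p a - p%:R^-1| <= (a%:R + 1) / p%:R ^+ 2.
Proof.
move=> pp a2; rewrite /G -exprVn; set t : R := p%:R^-1.
have /andP[t0 t1] := invp_itv pp; rewrite -/t in t0 t1.
have h1 : 1 - a%:R * t <= (1 - t) ^+ a.
  elim: a {a2} => [|a IH]; first by rewrite mul0r subr0 expr0.
  have t1' : 0 <= 1 - t by lra.
  rewrite exprS; apply: le_trans (ler_wpM2l t1' IH).
  rewrite -addn1 natrD; have : 0 <= a%:R * t ^+ 2 by rewrite mulr_ge0// exprn_ge0// ltW.
  by rewrite expr2; lra.
have h2 : (1 - t) ^+ a <= 1 by rewrite exprn_ile1//; lra.
have h3 : `|(- t) ^+ a * (1 - t)| <= t ^+ 2.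
  rewrite normrM normrX normrN (gtr0_norm t0) ger0_norm; last by lra.
  have h : t ^+ a <= t ^+ 2 by rewrite ler_wiXn2l//; lra.
  by apply: le_trans h; rewrite ler_piMr ?exprn_ge0//; lra.
rewrite addrAC; apply: le_trans (ler_normD _ _) _; rewrite mulrDl mul1r lerD//.
by rewrite ler_norml expr2; nra.
Qed.

Lemma normr_G_le p a : prime p -> (2 <= a)%N -> `|G R p a| <= p%:R^-1.
Proof.
move=> pp a2; rewrite /G; set t : R := p%:R^-1.
have /andP[t0 t1] := invp_itv pp; rewrite -/t in t0 t1.
have t2 : 0 <= 1 - t by lra.
apply: le_trans (ler_normD _ _) _.
rewrite !normrM !normrX normrN (gtr0_norm t0) (ger0_norm t2).
have h1 : (1 - t) ^+ a <= 1 - t.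
  by rewrite -[leRHS]expr1 ler_wiXn2l//; [lra|exact: ltnW].
have h2 : t ^+ a <= t ^+ 2 by rewrite ler_wiXn2l//; lra.
rewrite expr2 in h2; nra.
Qed.

Lemma prod_G_le p (s : seq nat) : prime p -> (2 <= size s)%N ->
  all (leq 2) s -> `|\prod_(a <- s) G R p a| <= p%:R ^- 2.
Proof.
move=> pp s2 sa; have /andP[t0 t1] := invp_itv pp.
apply: (@le_trans _ _ (p%:R^-1 ^+ size s)); last first.
  by rewrite -exprVn ler_wiXn2l//; lra.
elim: s sa {s2} => [|a s IH] /=; first by rewrite big_nil normr1.
move=> /andP[a2 /IH IHs]; rewrite big_cons normrM exprS ler_pM//.
exact: normr_G_le.
Qed.

(** Comparison with the telescoping bound 1/(n+1)^2 <= 1/n - 1/(n+1). *)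
Lemma sum_prime_tail (h : nat -> R) M N :
  (forall p, prime p -> `|h p| <= p%:R ^- 2) -> (0 < M)%N -> (M <= N)%N ->
  `|\sum_(M.+1 <= p < N.+1 | prime p) h p| <= M%:R^-1 - N%:R^-1.
Proof.
move=> hp M0; elim: N => [|N IH]; first by case: M M0.
rewrite leq_eqVlt => /orP[/eqP <-|]; first by rewrite big_geq// normr0 subrr.
rewrite ltnS => MN; have N0 : 0 < N%:R :> R by rewrite ltr0n (leq_trans M0).
rewrite big_mkcond big_nat_recr//= -big_mkcond/=.
apply: le_trans (ler_normD _ _) _.
have -> : M%:R^-1 - N.+1%:R^-1 = (M%:R^-1 - N%:R^-1) + (N%:R^-1 - N.+1%:R^-1) :> R by ring.
apply: lerD; first exact: IH.
have h1 : N.+1%:R ^- 2 <= N%:R^-1 - N.+1%:R^-1 :> R.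
  have N1E : N.+1%:R = N%:R + 1 :> R by rewrite natr1.
  rewrite N1E -subr_ge0.
  rewrite (_ : _ - _ = (N%:R * (N%:R + 1) ^+ 2)^-1).
    by rewrite invr_ge0 mulr_ge0 ?exprn_ge0 ?addr_ge0.
  by field; rewrite ?natr1 ?nat1r !gt_eqF.
case: ifP => [/hp/le_trans|_]; first exact.
by rewrite normr0 (le_trans _ h1).
Qed.

Lemma Dalpha_dist_le (s : seq nat) (z : R) : (2 <= size s)%N -> all (leq 2) s ->
  4 <= z -> `|\sum_(1 <= p < (Num.truncn z).+1 | prime p) \prod_(a <- s) G R p a
    - Dalpha R s| <= 2 / ln z.
Proof.
move=> s2 sa z4.
pose h p : R := \prod_(a <- s) G R p a.
pose f N : R := \sum_(0 <= p < N | prime p) h p.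
have hp p : prime p -> `|h p| <= p%:R ^- 2 by move=> pp; exact: prod_G_le.
(* The partial sums defining [Dalpha] stop before their index, so the cutoff p <= M is index M+1. *)
have fE N : f N.+1 = \sum_(1 <= p < N.+1 | prime p) h p.
  by rewrite /f big_mkcond big_ltn//= add0r -big_mkcond.
have near_le M : (0 < M)%N -> (\forall N \near \oo, `|f M.+1 - f N| <= M%:R^-1)%classic.
  move=> M0; exists M.+1 => // -[//|N]/=; rewrite ltnS => MN.
  rewrite distrC !fE (big_cat_nat _ (n := M.+1))//= addrAC subrr add0r.
  by apply: le_trans (sum_prime_tail hp M0 MN) _; rewrite gerBl invr_ge0.
have cf : (cvg (f N @[N --> \oo]))%classic.
  apply: cvg_of_cauchy_at => e e0.
  exists (Num.truncn e^-1).+2.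
  apply: filterS (near_le (Num.truncn e^-1).+1 isT) => N /le_trans; apply.
  by rewrite invf_ple ?posrE// ltW// truncnS_gt.
have N2 : (2 <= Num.truncn z)%N by rewrite truncn_ge_nat//; lra.
have := lim_dist_le (eventually_filter) cf (near_le _ (ltnW N2)); rewrite fE => /le_trans; apply.
have z0 : 0 <= z by lra.
have lz : 0 < ln z by rewrite ln_gt0//; lra.
have := truncn_itv z0; rewrite -natr1 => /andP[zl zu].
have n2 : 2 <= (Num.truncn z)%:R :> R by rewrite ler_nat.
have := ln_sublinear (_ : 0 < z) => /(_ _) lzz.
rewrite -invf_div lef_pV2 ?posrE ?divr_gt0//; last by lra.
have : ln z < z by apply: lzz; lra.
lra.
Qed.

End local_factor.

(** * Power sums compared with moments of independent variables *)

Section model.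
Variable R : realType.
Variable c : R.

(* The j-th moment of [c + \sum_(p <- P) X_p] for independent [X_p] taking the
   value [1 - 1/p] with probability [1/p] and [- 1/p] otherwise; then
   [G p i] is the i-th moment of [X_p]. *)
Fixpoint model_moment (P : seq nat) (j : nat) : R :=
  if P is q :: P' then
    \sum_(i < j.+1) 'C(j, i)%:R * G R q i * model_moment P' (j - i)
  else c ^+ j.

Definition add_dev (P : seq nat) (n : nat) : R :=
  c + \sum_(p <- P) ((p %| n)%:R - p%:R^-1).

Lemma count_multiples (x : R) (d : nat) : 0 <= x -> (0 < d)%N ->
  `|\sum_(1 <= n < (Num.truncn x).+1 | (d %| n)%N) 1 - x / d%:R| <= 1.
Proof.
move=> x0 d0; have dR : 0 < d%:R :> R by rewrite ltr0n.
set N := Num.truncn x.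
have -> : \sum_(1 <= n < N.+1 | (d %| n)%N) 1 = (N %/ d)%:R :> R.
  rewrite divn_count_dvd natr_sum big_mkcond; apply: eq_bigr => n _.
  by case: (d %| n)%N.
have /andP[Nx xN] := truncn_itv x0; rewrite -/N in Nx xN.
have h1 : (N %/ d)%:R <= x / d%:R.
  by rewrite ler_pdivlMr// (le_trans _ Nx)// -natrM ler_nat leq_divM.
have h2 : x / d%:R <= (N %/ d)%:R + 1.
  rewrite ler_pdivrMr// (le_trans (ltW xN))// natr1 -natrM ler_nat.
  exact: ltn_ceil.
by rewrite ler_norml; lra.
Qed.

(** These are the two coefficients of ((q | n) - 1/q)^i as an affine function of the indicator of q
    | n. The bound 2^i makes each added prime raise the base of the error by 2. *)
Lemma coef_norm_le (q i : nat) : prime q ->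
  `|(- q%:R^-1) ^+ i| + `|(1 - q%:R^-1) ^+ i - (- q%:R^-1) ^+ i| <= 2 ^+ i :> R.
Proof.
move=> pq; have /andP[] := invp_itv R pq; set t := q%:R^-1 => t0 t1.
case: i => [|i]; first by rewrite !expr0 subrr normr0 normr1 addr0.
have h1 : `|(- t) ^+ i.+1| <= t.
  rewrite normrX normrN gtr0_norm// -[leRHS]expr1 ler_wiXn2l//; lra.
have h2 : `|(1 - t) ^+ i.+1| <= 1 - t.
  rewrite normrX ger0_norm; last by lra.
  by rewrite -[leRHS]expr1 ler_wiXn2l//; lra.
have h3 : 2 <= 2 ^+ i.+1 :> R by rewrite exprS ler_peMr// exprn_ege1//; lra.
have := ler_normB ((1 - t) ^+ i.+1) ((- t) ^+ i.+1); lra.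
Qed.

(* The condition [d %| n] is what lets the induction on [P] go through. *)
Lemma moment_model (x : R) (P : seq nat) (j d : nat) : 0 <= x -> (0 < d)%N ->
  uniq P -> all prime P -> all (coprime d) P ->
  `|\sum_(1 <= n < (Num.truncn x).+1 | (d %| n)%N) add_dev P n ^+ j
    - x / d%:R * model_moment P j| <= (`|c| + 2 * (size P)%:R) ^+ j.
Proof.
move=> x0; elim: P j d => [|q P IH] j d d0 /=.
  move=> _ _ _; rewrite mulr0 addr0.
  rewrite [X in `|X - _|](_ : _ = (\sum_(1 <= n < (Num.truncn x).+1 | (d %| n)%N) 1) * c ^+ j).
    by rewrite -mulrBl normrM normrX ler_piMl ?exprn_ge0// count_multiples.
  rewrite mulr_suml; apply: eq_bigr => n _.
  by rewrite /add_dev big_nil addr0 mul1r.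
move=> /andP[qP uP] /andP[pq prP] /andP[dq dP].
pose t : R := q%:R^-1.
pose al i : R := (- t) ^+ i; pose be i : R := (1 - t) ^+ i - (- t) ^+ i.
pose T d j : R := \sum_(1 <= n < (Num.truncn x).+1 | (d %| n)%N) add_dev P n ^+ j.
have q0 : (0 < q)%N by exact: prime_gt0.
have dR : d%:R != 0 :> R by rewrite pnatr_eq0 -lt0n.
have qR : q%:R != 0 :> R by rewrite pnatr_eq0 -lt0n.
have TE : \sum_(1 <= n < (Num.truncn x).+1 | (d %| n)%N) add_dev (q :: P) n ^+ j =
    \sum_(i < j.+1) 'C(j, i)%:R * (al i * T d (j - i)%N + be i * T (d * q)%N (j - i)%N).
  transitivity (\sum_(1 <= n < (Num.truncn x).+1 | (d %| n)%N) \sum_(i < j.+1)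
      'C(j, i)%:R * (al i * add_dev P n ^+ (j - i)
        + be i * ((q %| n)%N)%:R * add_dev P n ^+ (j - i))).
    apply: eq_bigr => n _.
    have -> : add_dev (q :: P) n = add_dev P n + ((q %| n)%N%:R - t).
      by rewrite /add_dev big_cons -/t; ring.
    rewrite exprDn; apply: eq_bigr => i _; rewrite -mulr_natl; congr (_ * _).
    rewrite /al /be; case: (q %| n)%N => /=; rewrite ?sub0r.
      by move: ((1 - t) ^+ i) ((- t) ^+ i) => u v; ring.
    by move: ((1 - t) ^+ i) ((- t) ^+ i) => u v; ring.
  rewrite exchange_big; apply: eq_bigr => i _ /=.
  rewrite -mulr_sumr big_split/= -mulr_sumr; congr (_ * (_ + _)).
  rewrite /T mulr_sumr [LHS]big_mkcond [RHS]big_mkcond; apply: eq_bigr => n _.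
  by rewrite Gauss_dvd//; case: (d %| n)%N; case: (q %| n)%N => //=; ring.
rewrite TE mulr_sumr -sumrB.
(* The target error is expanded by the same binomial theorem as the power sum, so the two can be
   compared term by term. *)
have -> : (`|c| + 2 * (size P).+1%:R) ^+ j =
    \sum_(i < j.+1) 'C(j, i)%:R * (2 ^+ i * (`|c| + 2 * (size P)%:R) ^+ (j - i)).
  rewrite -[(size P).+1]addn1 natrD mulrDr mulr1 addrA exprDn; apply: eq_bigr => i _.
  by rewrite -mulr_natl [_ * 2 ^+ i]mulrC.
apply: le_trans (ler_norm_sum _ _ _) _; apply: ler_sum => i _.
(* The main terms match because al_i + be_i / q = G(q^i); the induction hypothesis is then used at
   both [d] and [d * q]. *)
have -> : 'C(j, i)%:R * (al i * T d (j - i)%N + be i * T (d * q)%N (j - i)%N)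
    - x / d%:R * ('C(j, i)%:R * G R q i * model_moment P (j - i))
  = 'C(j, i)%:R * (al i * (T d (j - i)%N - x / d%:R * model_moment P (j - i))
     + be i * (T (d * q)%N (j - i)%N - x / (d * q)%:R * model_moment P (j - i))).
  rewrite /G /be /al -/t natrM; move: ((1 - t) ^+ i) ((- t) ^+ i) => u v.
  by rewrite /t; field; apply/andP.
rewrite normrM ger0_norm// ler_wpM2l//.
apply: le_trans (ler_normD _ _) _; rewrite !normrM.
apply: le_trans (ler_wpM2r _ (coef_norm_le i pq)); last first.
  by rewrite exprn_ge0// addr_ge0// mulr_ge0.
rewrite mulrDl; apply: lerD; apply: ler_wpM2l => //; apply: IH => //.
  by rewrite muln_gt0 d0.
apply/allP => p pP; rewrite coprimeMl (allP dP _ pP)/=.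
rewrite prime_coprime// dvdn_prime2//; last exact: (allP prP).
by apply: contraNneq qP => ->.
Qed.


Lemma model_moment0 P : model_moment P 0 = 1.
Proof.
elim: P => [|q P IH] /=; first by rewrite expr0.
by rewrite big_ord_recl big_ord0 bin0 G_exp0 IH; ring.
Qed.

End model.

(** * Closed forms of the model moments *)

Section closed_forms.
Variables (R : realType) (c : R).
Implicit Types (P : seq nat) (a b : nat).
Local Notation M := (model_moment c).
Local Notation S P a := (\sum_(p <- P) G R p a).
Local Notation D P s := (\sum_(p <- P) \prod_(a <- s) G R p a).

Lemma model_moment_rec q P (j : nat) :
  M (q :: P) j = \sum_(0 <= i < j.+1) 'C(j, i)%:R * G R q i * M P (j - i).
Proof. by rewrite big_mkord. Qed.

Local Ltac expand_moment :=
  rewrite model_moment_rec ?big_nat_recr //= big_geq // ?big_cons ?big_nil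
    ?G_exp0 ?G_exp1 ?model_moment0;
  repeat match goal with |- context ['C(?n, ?k)] =>
    let v := eval vm_compute in 'C(n, k) in change ('C(n, k)) with v end.

Lemma model_moment1 P : M P 1 = c.
Proof.
elim: P => [|q P IH]; first by rewrite /= expr1.
by expand_moment; rewrite IH; ring.
Qed.

Lemma model_moment2 P : M P 2 = c ^+ 2 + S P 2.
Proof.
elim: P => [|q P IH]; first by rewrite /= big_nil addr0.
expand_moment; rewrite IH model_moment1.
ring.
Qed.

Lemma model_moment3 P : M P 3 = c ^+ 3 + 3 * c * S P 2 + S P 3.
Proof.
elim: P => [|q P IH]; first by rewrite /= !big_nil; ring.
expand_moment; rewrite IH model_moment2 model_moment1; ring.
Qed.

(** Since G(p) = 0 at exponent 1, only blocks of size at least 2 occur. The difference of S(2)^2 and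
    D(2,2) is the sum over ordered pairs of distinct primes when [P] has no repetition; 3 counts the
    pairings of four factors. *)
Lemma model_moment4 P : M P 4 =
  S P 4 + 3 * (S P 2 ^+ 2 - D P [:: 2; 2]%N) + 4 * c * S P 3
  + 6 * c ^+ 2 * S P 2 + c ^+ 4.
Proof.
elim: P => [|q P IH]; first by rewrite /= !big_nil; ring.
expand_moment; rewrite IH model_moment3 model_moment2 model_moment1; ring.
Qed.

Lemma model_moment5 P : M P 5 =
  S P 5 + 10 * (S P 3 * S P 2 - D P [:: 3; 2]%N)
  + 5 * c * (S P 4 + 3 * (S P 2 ^+ 2 - D P [:: 2; 2]%N))
  + 10 * c ^+ 2 * S P 3 + 10 * c ^+ 3 * S P 2 + c ^+ 5.
Proof.
elim: P => [|q P IH]; first by rewrite /= !big_nil; ring.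
expand_moment; rewrite IH model_moment4 model_moment3 model_moment2 model_moment1; ring.
Qed.

(** The bracket with coefficient 2 on D(2,2,2) is the inclusion-exclusion form of a sum over triples
    of distinct positions in [P]. The factors 15, 10 and 15 count partitions of six factors into
    blocks 4+2, 3+3 and 2+2+2. *)
Lemma model_moment6 P : M P 6 =
  S P 6 + 15 * (S P 4 * S P 2 - D P [:: 4; 2]%N)
  + 10 * (S P 3 ^+ 2 - D P [:: 3; 3]%N)
  + 15 * (S P 2 ^+ 3 - 3 * S P 2 * D P [:: 2; 2]%N + 2 * D P [:: 2; 2; 2]%N)
  + 6 * c * (S P 5 + 10 * (S P 3 * S P 2 - D P [:: 3; 2]%N))
  + 15 * c ^+ 2 * (S P 4 + 3 * (S P 2 ^+ 2 - D P [:: 2; 2]%N))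
  + 20 * c ^+ 3 * S P 3 + 15 * c ^+ 4 * S P 2 + c ^+ 6.
Proof.
elim: P => [|q P IH]; first by rewrite /= !big_nil; ring.
expand_moment; rewrite IH model_moment5 model_moment4 model_moment3 model_moment2.
by rewrite model_moment1; ring.
Qed.

End closed_forms.

(** * Error calculus *)

Section asymptotics.
Variable R : realType.
Implicit Types (x z : R) (f g : R -> R) (d e m k n : nat).

(* [f = g + O(L ^ e / ln z)] with [f] and [g] of size [O(L ^ d)], [L = loglog z]. *)
Definition logapprox d e f g := exists2 K : R, 0 <= K &
  forall z : R, 4 <= z -> 1 <= loglog z ->
  [/\ `|f z| <= K * loglog z ^+ d, `|g z| <= K * loglog z ^+ d
    & `|f z - g z| <= K * (loglog z ^+ e / ln z)].

Lemma ln_gt1 z : 4 <= z -> 1 <= loglog z -> 1 < ln z.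
Proof.
move=> z4 h; apply: (le_lt_trans h); apply: ln_sublinear.
by rewrite ln_gt0//; lra.
Qed.

Lemma logapprox_le d e d' e' f g : (d <= d')%N -> (e <= e')%N ->
  logapprox d e f g -> logapprox d' e' f g.
Proof.
move=> dd ee [K K0 h]; exists K => // z z4 L1; have [h1 h2 h3] := h z z4 L1.
have lz := ln_gt1 z4 L1.
have hd : K * loglog z ^+ d <= K * loglog z ^+ d' by rewrite ler_wpM2l// ler_weXn2l.
split; try exact: le_trans hd.
apply: le_trans h3 _; rewrite ler_wpM2l// ler_wpM2r ?ler_weXn2l//.
by rewrite invr_ge0; lra.
Qed.

Lemma logapprox_const a : logapprox 0 0 (fun=> a) (fun=> a).
Proof.
exists `|a| => // z z4 L1; have lz := ln_gt1 z4 L1.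
rewrite expr0 mulr1 subrr normr0; split => //.
by rewrite mulr_ge0// divr_ge0//; lra.
Qed.

(** The size of [f] follows from that of [g], since 1 / ln z <= 1 <= L^d once L >= 1. *)
Lemma logapprox_of_dist d f g (K1 K2 : R) :
  (forall z, 4 <= z -> 1 <= loglog z -> `|g z| <= K1 * loglog z ^+ d) ->
  (forall z, 4 <= z -> `|f z - g z| <= K2 / ln z) -> logapprox d 0 f g.
Proof.
move=> h1 h2; exists (`|K1| + `|K2|); first exact: addr_ge0.
move=> z z4 L1; have lz := ln_gt1 z4 L1.
have Ld : 1 <= loglog z ^+ d by rewrite exprn_ege1.
have g1 : `|g z| <= `|K1| * loglog z ^+ d.
  by apply: le_trans (h1 z z4 L1) _; rewrite ler_wpM2r ?ler_norm//; lra.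
have g2 : `|f z - g z| <= `|K2| / ln z.
  by apply: le_trans (h2 z z4) _; rewrite ler_wpM2r ?ler_norm ?invr_ge0//; lra.
have g3 : `|K2| / ln z <= `|K2| * loglog z ^+ d.
  by rewrite ler_wpM2l// (@le_trans _ _ 1)// invf_le1; lra.
have K10 : 0 <= `|K1| := normr_ge0 _.
have K20 : 0 <= `|K2| := normr_ge0 _.
have iz : 0 <= (ln z)^-1 by rewrite invr_ge0; lra.
rewrite expr0 mul1r !mulrDl; split.
- by have := ler_normD (f z - g z) (g z); rewrite subrK; lra.
- have : 0 <= `|K2| * loglog z ^+ d by rewrite mulr_ge0//; lra.
  by lra.
- have : 0 <= `|K1| / ln z by rewrite mulr_ge0.
  by lra.
Qed.

Lemma logapproxN d e f g : logapprox d e f g -> logapprox d e (fun z => - f z) (fun z => - g z).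
Proof.
move=> [K K0 h]; exists K => // z z4 L1; have [h1 h2 h3] := h z z4 L1.
by rewrite -opprD !normrN.
Qed.

Lemma logapproxZ a d e f g : logapprox d e f g ->
  logapprox d e (fun z => a * f z) (fun z => a * g z).
Proof.
move=> [K K0 h]; exists (`|a| * K); first by rewrite mulr_ge0.
move=> z z4 L1; have [h1 h2 h3] := h z z4 L1.
by rewrite -mulrBr !normrM -!(mulrA `|a| K) !ler_wpM2l.
Qed.

Lemma logapproxD d1 e1 d2 e2 f1 g1 f2 g2 : logapprox d1 e1 f1 g1 -> logapprox d2 e2 f2 g2 ->
  logapprox (maxn d1 d2) (maxn e1 e2) (fun z => f1 z + f2 z) (fun z => g1 z + g2 z).
Proof.
move=> /(logapprox_le (leq_maxl d1 d2) (leq_maxl e1 e2)) [K1 K10 h1].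
move=> /(logapprox_le (leq_maxr d1 d2) (leq_maxr e1 e2)) [K2 K20 h2].
exists (K1 + K2); first exact: addr_ge0.
move=> z z4 L1; have [p1 p2 p3] := h1 z z4 L1; have [q1 q2 q3] := h2 z z4 L1.
split; rewrite ?opprD ?[f1 z + f2 z + _]addrACA mulrDl;
  by apply: le_trans (ler_normD _ _) _; apply: lerD.
Qed.

(** From f1 f2 - g1 g2 = f1 (f2 - g2) + g2 (f1 - g1): each error is multiplied by the size of the
    other factor. *)
Lemma logapproxM d1 e1 d2 e2 f1 g1 f2 g2 : logapprox d1 e1 f1 g1 -> logapprox d2 e2 f2 g2 ->
  logapprox (d1 + d2) (maxn (d1 + e2) (d2 + e1))
    (fun z => f1 z * f2 z) (fun z => g1 z * g2 z).
Proof.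
move=> [K1 K10 h1] [K2 K20 h2].
exists (2 * (K1 * K2)); first by rewrite !mulr_ge0.
move=> z z4 L1; have [p1 p2 p3] := h1 z z4 L1; have [q1 q2 q3] := h2 z z4 L1.
have lz := ln_gt1 z4 L1; have L0 : 0 <= loglog z by lra.
have K120 : 0 <= K1 * K2 by exact: mulr_ge0.
have mul a b A B i j : `|a| <= A * loglog z ^+ i -> `|b| <= B * j ->
    `|a * b| <= (A * B) * (loglog z ^+ i * j).
  by move=> ha hb; rewrite normrM mulrACA ler_pM.
split.
- apply: le_trans (mul _ _ _ _ _ _ p1 q1) _; rewrite -exprD ler_wpM2r ?exprn_ge0//; lra.
- apply: le_trans (mul _ _ _ _ _ _ p2 q2) _; rewrite -exprD ler_wpM2r ?exprn_ge0//; lra.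
have -> : f1 z * f2 z - g1 z * g2 z = f1 z * (f2 z - g2 z) + g2 z * (f1 z - g1 z) by ring.
apply: le_trans (ler_normD _ _) _.
rewrite -mulrA mulr_natl mulr2n; apply: lerD.
  apply: le_trans (mul _ _ _ _ _ _ p1 q3) _.
  rewrite ler_wpM2l// mulrA -exprD ler_wpM2r ?invr_ge0 ?ler_weXn2l ?leq_maxl//; lra.
apply: le_trans (mul _ _ _ _ _ _ q2 p3) _.
rewrite [K2 * K1]mulrC ler_wpM2l// mulrA -exprD ler_wpM2r ?invr_ge0 ?ler_weXn2l ?leq_maxr//; lra.
Qed.

Lemma logapproxX d e f g n : logapprox d e f g ->
  logapprox (d * n) (d * n.-1 + e) (fun z => f z ^+ n) (fun z => g z ^+ n).
Proof.
move=> h; case: n => [|n].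
  by rewrite muln0; apply: logapprox_le (logapprox_const 1).
elim: n => [|n IH].
  rewrite muln1 muln0 add0n; under eq_fun do rewrite expr1.
  by under [X in logapprox _ _ _ X]eq_fun do rewrite expr1.
have := logapproxM h IH.
under eq_fun do rewrite -exprS; under [X in logapprox _ _ _ X]eq_fun do rewrite -exprS.
by apply: logapprox_le; [rewrite -mulnS|rewrite geq_max/= addnA -mulnS leqnn].
Qed.

(** * From [omega] to the model: transfer of the asymptotics *)

Definition primes_le z := [seq p <- index_iota 1 (Num.truncn z).+1 | prime p].

Definition mertens_err z : R := \sum_(p <- primes_le z) p%:R^-1 - loglog z.

(** Positivity of [n] matters: [primes 0] is empty although every prime divides 0. *)
Lemma omega_sum z n : 0 <= z -> (0 < n)%N ->
  omega z n = (\sum_(p <- primes_le z) (p %| n))%N.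
Proof.
move=> z0 n0; have -> : (\sum_(p <- primes_le z) (p %| n) = count (dvdn^~ n) (primes_le z))%N.
  by rewrite -sum1_count [RHS]big_mkcond; apply: eq_bigr => p _; case: (p %| n)%N.
rewrite /omega -!size_filter.
apply/perm_size/uniq_perm; rewrite ?filter_uniq ?primes_uniq ?iota_uniq//.
move=> p; rewrite !mem_filter mem_primes mem_index_iota ltnS truncn_ge_nat//.
by case: (boolP (prime p)) => [/prime_gt0 ->|_]; rewrite ?andbF// n0 /= andbC.
Qed.

Lemma omega_add_dev z n : 0 <= z -> (0 < n)%N ->
  (omega z n)%:R - loglog z = add_dev (mertens_err z) (primes_le z) n.
Proof.
move=> z0 n0; rewrite omega_sum// /add_dev /mertens_err natr_sum sumrB; ring.
Qed.

(** The vacuous condition 1 | n puts the sum in the form of [moment_model] with d = 1. *)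
Lemma moment_add_dev k x z : 0 <= z ->
  moment k x z = \sum_(1 <= n < (Num.truncn x).+1 | (1 %| n)%N)
    add_dev (mertens_err z) (primes_le z) n ^+ k.
Proof.
move=> z0; rewrite /moment big_nat_cond [RHS]big_nat_cond.
apply: eq_big => [n|n]; first by rewrite dvd1n.
by move=> /andP[/andP[n0 _] _]; rewrite omega_add_dev.
Qed.

Lemma logapprox_mertens_err : logapprox 0 0 mertens_err (fun=> mertensB R).
Proof.
apply: (@logapprox_of_dist _ _ _ `|mertensB R| (30 + 2 * 0)) => z z4.
  by rewrite expr0 mulr1.
rewrite /mertens_err big_filter; apply: mertens2 => // p _.
by rewrite subrr normr0 mul0r.
Qed.

Lemma logapprox_Gsum a : (2 <= a)%N ->
  logapprox 1 0 (fun z => \sum_(p <- primes_le z) G R p a)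
    (fun z => loglog z + Balpha R a).
Proof.
move=> a2; apply: (@logapprox_of_dist _ _ _ (1 + `|Balpha R a|) (30 + 2 * (a%:R + 1))) => z z4.
  move=> L1; apply: le_trans (ler_normD _ _) _.
  rewrite expr1 mulrDl mul1r ger0_norm; last by lra.
  by rewrite lerD2l ler_peMr.
rewrite big_filter opprD addrA; apply: mertens2 => // p pp.
exact: normr_GB_le.
Qed.

Lemma logapprox_Dsum s : (2 <= size s)%N -> all (leq 2) s ->
  logapprox 0 0 (fun z => \sum_(p <- primes_le z) \prod_(a <- s) G R p a)
    (fun=> Dalpha R s).
Proof.
move=> s2 sa; apply: (@logapprox_of_dist _ _ _ `|Dalpha R s| 2) => z z4.
  by rewrite expr0 mulr1.
by rewrite big_filter; apply: Dalpha_dist_le.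
Qed.

Lemma moment_asymp k m d e (T : R -> R) : (0 < k)%N -> (e <= m)%N ->
  logapprox d e (fun z => model_moment (mertens_err z) (primes_le z) k) T ->
  exists2 C : R, 0 <= C & forall x z, 1 <= x -> 4 <= z -> 1 <= loglog z ->
    z <= x `^ (1 / k%:R) ->
    `|moment k x z - x * T z| <= C * (x * loglog z ^+ m / ln z).
Proof.
move=> k0 em [K K0 hT]; have [Kc Kc0 hc] := logapprox_mertens_err.
exists ((Kc + 28) ^+ k + K); first by rewrite addr_ge0// exprn_ge0//; lra.
move=> x z x1 z4 L1 zx; have lz := ln_gt1 z4 L1.
have x0 : 0 <= x by lra.
have z0 : 0 <= z by lra.
have kR : 0 < k%:R :> R by rewrite ltr0n.
have zkx : z ^+ k <= x.
  rewrite -powR_mulrn//; apply: (le_trans (ge0_ler_powR _ _ _ zx)); rewrite ?nnegrE ?powR_ge0//.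
  by rewrite -powRrM mul1r mulVf ?gt_eqF// powRr1.
have Lm : 1 <= loglog z ^+ m by rewrite exprn_ege1.
have [_ _ hTz] := hT z z4 L1; have [hcz _ _] := hc z z4 L1.
have := @moment_model R (mertens_err z) x (primes_le z) k 1 x0 isT.
rewrite filter_uniq ?iota_uniq// filter_all => /(_ isT isT).
have -> : all (coprime 1) (primes_le z) by apply/allP => p _; rewrite coprime1n.
rewrite divr1 -moment_add_dev// => /(_ isT) hm.
(* The bounded term is at most Kc z / ln z because z / ln z >= 1, and 28 = 2 * 14 comes from
   [prime_count]. *)
have hP : `|mertens_err z| + 2 * (size (primes_le z))%:R <= (Kc + 28) * (z / ln z).
  have h1 : (size (primes_le z))%:R <= 14 * z / ln z :> R by apply: prime_count; lra.
  have h2 : 1 <= z / ln z.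
    by rewrite ler_pdivlMr ?mul1r; [apply/ltW/ln_sublinear; lra|lra].
  by rewrite expr0 mulr1 in hcz; nra.
(* The range of [z] gives z^k <= x, and ln z > 1 with k >= 1 gives (ln z)^k >= ln z, so (z / ln z)^k
   <= x / ln z. *)
have E1 : (`|mertens_err z| + 2 * (size (primes_le z))%:R) ^+ k
    <= (Kc + 28) ^+ k * (x * loglog z ^+ m / ln z).
  apply: (le_trans (lerXn2r k _ _ hP)); rewrite ?nnegrE.
  - by rewrite addr_ge0// mulr_ge0.
  - by apply: mulr_ge0; [lra|apply: divr_ge0; lra].
  rewrite exprMn ler_wpM2l ?exprn_ge0//; first lra.
  rewrite expr_div_n ler_pM ?exprn_ge0 ?invr_ge0 ?exprn_ge0//; [lra | | ].
    by rewrite (le_trans zkx)// ler_peMr.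
  rewrite lef_pV2 ?posrE ?exprn_gt0//; [|lra|lra].
  by rewrite -[leLHS]expr1 ler_weXn2l//; lra.
have E2 : K * (loglog z ^+ e / ln z) <= K * (loglog z ^+ m / ln z).
  rewrite ler_wpM2l// ler_wpM2r ?ler_weXn2l// invr_ge0; lra.
have -> : moment k x z - x * T z =
   (moment k x z - x * model_moment (mertens_err z) (primes_le z) k)
   + x * (model_moment (mertens_err z) (primes_le z) k - T z) by ring.
apply: le_trans (ler_normD _ _) _; rewrite mulrDl lerD//; first exact: le_trans hm E1.
rewrite normrM ger0_norm// -mulrA mulrCA ler_wpM2l//.
exact: le_trans hTz E2.
Qed.

End asymptotics.

(** * Asymptotics of the model moments of orders 2 to 6 *)

Section closed_form_asymptotics.
Variable R : realType.
Local Notation c := (@mertens_err R).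
Local Notation b := (mertensB R).
Local Notation P := (@primes_le R).
Local Notation M z k := (model_moment (c z) (P z) k).
Local Notation S z a := (loglog z + Balpha R a).
Local Notation D s := (Dalpha R s).

Local Ltac prove_logapprox :=
  repeat first [ apply: logapprox_mertens_err | apply: logapprox_Gsum => //
    | apply: logapprox_Dsum => // | apply: logapprox_const | apply: logapproxZ
    | apply: logapproxX | apply: logapproxM | apply: logapproxN
    | apply: logapproxD ].

Lemma logapprox_moment2 : exists d e, (e <= 0)%N /\
  logapprox d e (fun z => M z 2) (fun z => b ^+ 2 + S z 2).
Proof.
(* The exponents stay open until the error calculus has computed them; the bound on [e] is then
   checked by evaluation. *)
do 2 eexists; split; last first.
  under eq_fun do rewrite model_moment2; prove_logapprox.
by [].
Qed.

Lemma logapprox_moment3 : exists d e, (e <= 1)%N /\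
  logapprox d e (fun z => M z 3) (fun z => b ^+ 3 + 3 * b * S z 2 + S z 3).
Proof.
do 2 eexists; split; last first.
  under eq_fun do rewrite model_moment3; prove_logapprox.
by [].
Qed.

Lemma logapprox_moment4 : exists d e, (e <= 1)%N /\
  logapprox d e (fun z => M z 4) (fun z =>
    S z 4 + 3 * (S z 2 ^+ 2 - D [:: 2; 2]%N) + 4 * b * S z 3
    + 6 * b ^+ 2 * S z 2 + b ^+ 4).
Proof.
do 2 eexists; split; last first.
  under eq_fun do rewrite model_moment4; prove_logapprox.
by [].
Qed.

Lemma logapprox_moment5 : exists d e, (e <= 2)%N /\
  logapprox d e (fun z => M z 5) (fun z =>
    S z 5 + 10 * (S z 3 * S z 2 - D [:: 3; 2]%N)
    + 5 * b * (S z 4 + 3 * (S z 2 ^+ 2 - D [:: 2; 2]%N))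
    + 10 * b ^+ 2 * S z 3 + 10 * b ^+ 3 * S z 2 + b ^+ 5).
Proof.
do 2 eexists; split; last first.
  under eq_fun do rewrite model_moment5; prove_logapprox.
by [].
Qed.

Lemma logapprox_moment6 : exists d e, (e <= 2)%N /\
  logapprox d e (fun z => M z 6) (fun z =>
    S z 6 + 15 * (S z 4 * S z 2 - D [:: 4; 2]%N)
    + 10 * (S z 3 ^+ 2 - D [:: 3; 3]%N)
    + 15 * (S z 2 ^+ 3 - 3 * S z 2 * D [:: 2; 2]%N + 2 * D [:: 2; 2; 2]%N)
    + 6 * b * (S z 5 + 10 * (S z 3 * S z 2 - D [:: 3; 2]%N))
    + 15 * b ^+ 2 * (S z 4 + 3 * (S z 2 ^+ 2 - D [:: 2; 2]%N))
    + 20 * b ^+ 3 * S z 3 + 15 * b ^+ 4 * S z 2 + b ^+ 6).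
Proof.
do 2 eexists; split; last first.
  under eq_fun do rewrite model_moment6; prove_logapprox.
by [].
Qed.

End closed_form_asymptotics.

(** * The five moment formulas, expanded in powers of [loglog z] *)

Theorem theorem3p3 (R : realType) :
  let b : R := mertensB R in
  let B : nat -> R := Balpha R in
  let D : seq nat -> R := Dalpha R in
  exists x0 z0 C : R, 1 <= x0 /\ 1 <= z0 /\
  [/\ (* (a) *)
      forall x z : R, x0 <= x -> z0 <= z -> z <= x `^ (1 / 2) ->
        `| moment 2 x z
           - (x * loglog z + (B 2%N + b ^+ 2) * x) |
        <= C * (x / ln z),
      (* (b) *)
      forall x z : R, x0 <= x -> z0 <= z -> z <= x `^ (1 / 3) ->
        `| moment 3 x z
           - ((1 + 3 * b) * x * loglog z
              + (B 3%N + 3 * B 2%N * b + b ^+ 3) * x) |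
        <= C * (x * loglog z / ln z),
      (* (c) *)
      forall x z : R, x0 <= x -> z0 <= z -> z <= x `^ (1 / 4) ->
        `| moment 4 x z
           - (3 * x * loglog z ^+ 2
              + (6 * B 2%N + 4 * b + 6 * b ^+ 2 + 1) * x * loglog z
              + (3 * B 2%N ^+ 2 - 3 * D [:: 2; 2]%N + B 4%N + 4 * B 3%N * b
                 + 6 * B 2%N * b ^+ 2 + b ^+ 4) * x) |
        <= C * (x * loglog z / ln z),
      (* (d) *)
      forall x z : R, x0 <= x -> z0 <= z -> z <= x `^ (1 / 5) ->
        `| moment 5 x z
           - ((10 + 15 * b) * x * loglog z ^+ 2
              + (10 * (B 3%N + B 2%N) + 1 + 5 * (6 * B 2%N + 1) * b
                 + 10 * b ^+ 2 + 10 * b ^+ 3) * x * loglog z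
              + (10 * (B 3%N * B 2%N - D [:: 3; 2]%N) + B 5%N
                 + 5 * (3 * B 2%N ^+ 2 - 3 * D [:: 2; 2]%N + B 4%N) * b
                 + 10 * B 3%N * b ^+ 2 + 10 * B 2%N * b ^+ 3 + b ^+ 5) * x) |
        <= C * (x * loglog z ^+ 2 / ln z) &
      (* (e) *)
      forall x z : R, x0 <= x -> z0 <= z -> z <= x `^ (1 / 6) ->
        `| moment 6 x z
           - (15 * x * loglog z ^+ 3
              + (45 * B 2%N + 25 + 60 * b + 45 * b ^+ 2) * x * loglog z ^+ 2
              + (45 * B 2%N ^+ 2 - 45 * D [:: 2; 2]%N + 15 * (B 2%N + B 4%N)
                 + 20 * B 3%N + 1
                 + 6 * (10 * (B 3%N + B 2%N) + 1) * b
                 + 15 * (6 * B 2%N + 1) * b ^+ 2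
                 + 20 * b ^+ 3 + 15 * b ^+ 4) * x * loglog z
              + (15 * B 2%N ^+ 3 - 45 * B 2%N * D [:: 2; 2]%N
                 + 30 * D [:: 2; 2; 2]%N
                 + 15 * (B 2%N * B 4%N - D [:: 4; 2]%N)
                 + 10 * (B 3%N ^+ 2 - D [:: 3; 3]%N) + B 6%N
                 + 6 * (10 * (B 2%N * B 3%N - D [:: 3; 2]%N) + B 5%N) * b
                 + 15 * (3 * B 2%N ^+ 2 - 3 * D [:: 2; 2]%N + B 4%N) * b ^+ 2
                 + 20 * B 3%N * b ^+ 3 + 15 * B 2%N * b ^+ 4 + b ^+ 6) * x) |
        <= C * (x * loglog z ^+ 2 / ln z)].
Proof.
move=> b B D.
have [d2 [e2 [h2 a2]]] := logapprox_moment2 R.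
have [d3 [e3 [h3 a3]]] := logapprox_moment3 R.
have [d4 [e4 [h4 a4]]] := logapprox_moment4 R.
have [d5 [e5 [h5 a5]]] := logapprox_moment5 R.
have [d6 [e6 [h6 a6]]] := logapprox_moment6 R.
have {h2 a2} [C2 C20 H2] := moment_asymp (isT : (0 < 2)%N) h2 a2.
have {h3 a3} [C3 C30 H3] := moment_asymp (isT : (0 < 3)%N) h3 a3.
have {h4 a4} [C4 C40 H4] := moment_asymp (isT : (0 < 4)%N) h4 a4.
have {h5 a5} [C5 C50 H5] := moment_asymp (isT : (0 < 5)%N) h5 a5.
have {h6 a6} [C6 C60 H6] := moment_asymp (isT : (0 < 6)%N) h6 a6.
rewrite -/b in H2 H3 H4 H5 H6.
(* The double exponential ensures loglog z >= 1, and 4 is the threshold of the Mertens estimates. *)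
pose z0 : R := Num.max 4 (expR (expR 1)).
have z0P z : z0 <= z -> 4 <= z /\ 1 <= loglog z.
  rewrite ge_max => /andP[z4 ze]; split => //.
  rewrite /loglog -[leLHS]expRK le_ln ?expR_gt0//.
  by rewrite -[leLHS]expRK le_ln ?expR_gt0.
pose C := C2 + C3 + C4 + C5 + C6.
(* Passes to the common constant [C] and to the stated main term, which equals the closed form by a
   ring identity. *)
have wk x z m (c : R) (y t u : R) : 1 <= x -> 4 <= z -> 1 <= loglog z -> c <= C ->
    u = y - t -> `|u| <= c * (x * loglog z ^+ m / ln z) ->
    `|y - t| <= C * (x * loglog z ^+ m / ln z).
  move=> x1 z4 L1 cC -> /le_trans; apply; rewrite ler_wpM2r//.
  have lz := ln_gt1 z4 L1.
  by rewrite divr_ge0 ?mulr_ge0 ?exprn_ge0//; lra.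
exists 1, z0, C; split; first by [].
split; first by rewrite /z0 le_max; apply/orP; left; lra.
split=> x z x1 /z0P[z4 L1] zx.
- have := wk x z 0%N _ _ _ _ x1 z4 L1 _ _ (H2 x z x1 z4 L1 zx).
  by rewrite expr0 mulr1; apply; [rewrite /C; lra|rewrite /B; ring].
- have := wk x z 1%N _ _ _ _ x1 z4 L1 _ _ (H3 x z x1 z4 L1 zx).
  by rewrite expr1; apply; [rewrite /C; lra|rewrite /B; ring].
- have := wk x z 1%N _ _ _ _ x1 z4 L1 _ _ (H4 x z x1 z4 L1 zx).
  by rewrite expr1; apply; [rewrite /C; lra|rewrite /B /D; ring].
- by apply: (wk x z 2%N _ _ _ _ x1 z4 L1 _ _ (H5 x z x1 z4 L1 zx));
    [rewrite /C; lra|rewrite /B /D; ring].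
- by apply: (wk x z 2%N _ _ _ _ x1 z4 L1 _ _ (H6 x z x1 z4 L1 zx));
    [rewrite /C; lra|rewrite /B /D; ring].
Qed.
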